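(* Let $n\ge 2$. If $|S_m(\Lambda_n)|\le a^m$ for some $a\ge 0$ and all $m=1,\ldots,n$, then $$\max_{k=1,\ldots,n}|\lambda_k|\le (1+\varepsilon_n)a,\qquad\text{where}\qquad \varepsilon_n:=\frac{2(\ln n-\ln\ln n)}{n}<\frac{2\ln n}{n}.$$ Furthermore, this estimate cannot be improved much, as for $n\ge n_0$ there exists $\tilde\Lambda_n=\{\tilde\lambda_k\}_{k=1}^n$ such that $$|S_m(\tilde\Lambda_n)|\le a^m,\quad m=1,\ldots,n,\qquad\text{and}\qquad |\tilde\lambda_1|=\left(1+\frac{c_n}{n}\right)a,\quad c_n\in[1/10,1].$$
   Context: $n$ is an integer and $\Lambda_n=\{\lambda_k\}_{k=1}^n$ is a family of $n$ complex numbers (repetitions allowed). Its power sums are $S_m(\Lambda_n)=\sum_{k=1}^n\lambda_k^m$, $m=1,2,\ldots$. Here $n_0$ is some positive integer and $\ln$ is the natural logarithm.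
   Formalization: The inequality ε_n < 2 ln n / n is asserted only for n ≥ 3, since at n = 2 it is false (ln ln 2 < 0, so ε_2 ≈ 1.06 > ln 2 ≈ 0.69); the bound on max|λ_k| is still stated for all n ≥ 2. *)

(* Defs.v *)
From HB Require Import structures.
From mathcomp Require Import all_boot all_order all_algebra.
From mathcomp Require Import reals exp.
From mathcomp Require Export complex.

Set Implicit Arguments.
Unset Strict Implicit.
Unset Printing Implicit Defensive.

Import Order.TTheory GRing.Theory Num.Theory.
Local Open Scope ring_scope.

(* The modulus is the library's [ComplexField.normc : R[i] -> R]; the generic
   norm `|z| on R[i] takes its values in R[i] (it is [(normc z)%:C]). *)
Notation cmod := ComplexField.Normc.normc.

(* The indices run over 'I_n, so the ordinal of value 0 carries the member
   usually written lambda_1. *)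
Definition power_sum (R : realType) (n : nat) (L : 'I_n -> R[i]) (m : nat) :
    R[i] :=
  \sum_(k < n) L k ^+ m.

Definition power_sums_le (R : realType) (n : nat) (L : 'I_n -> R[i]) (a : R) :
    Prop :=
  forall m : nat, (1 <= m <= n)%N -> cmod (power_sum L m) <= a ^+ m.

(* The moduli are nonnegative, so 0 as the default value of the iterated
   maximum is harmless when 0 < n. *)
Definition max_modulus (R : realType) (n : nat) (L : 'I_n -> R[i]) : R :=
  \big[Num.max/0]_(k < n) cmod (L k).

Definition eps (R : realType) (n : nat) : R :=
  2 * (ln (n%:R : R) - ln (ln (n%:R : R))) / n%:R.

(* Main.v *)
Require Import Defs.
From HB Require Import structures.
From mathcomp Require Import all_boot all_order all_algebra.
From mathcomp Require Import functions reals topology normedtype sequences.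
From mathcomp Require Import derive exp trigo.
From mathcomp Require Import zify ring lra.

(** Upper bound. By homogeneity let a = 1, and put
    p = prod_k (1 - lambda_k X) = exp (- sum_m S_m X^m / m).  Let h be the power
    series exp (sum_(m <= n) S_m X^m / m), with the power sums truncated at n.
    Newton's recursion m c_m = sum_i (+- S_i) c_(m - i) with |S_i| <= 1 forces
    all coefficients of p and of h to have modulus at most 1.  The logarithmic
    derivatives of p and h cancel up to degree n, so p h = 1 + O(X^(n+1)), and
    the same computation bounds its coefficient of degree n + x by n x / (n + x)
    for x > 0.  If some |lambda_k| = 1 + d with d > 0, evaluation of p h at
    1 / lambda_k, where p vanishes, gives
        1 <= sum_(x > 0) n x / (n + x) (1 + d)^-(n + x).
    Replacing the concave function x / (n + x) by its tangent at the mean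
    (1 + d) / d turns this into the closed inequality ([critical_ineq])
        d (1 + d)^n ((n + 1) d + 1) <= n (1 + d),
    whose two sides, after division by 1 + d, are an increasing function of d
    and a constant.  Hence d <= e as soon as the opposite inequality holds at e,
    and it remains to check the latter for e = eps n ([eps_supercritical]).

    With l = ln n and u = l - ln l one has eps n = 2 u / n and
    exp (2 u) = (n / l)^2.  The bound ln (1 + e) >= 2 e / (2 + e) reduces the
    check to l^2 (n + 2 u + u^2) <= 2 u (2 u + 1) (n - u^2), and the rational
    bounds 2 (l - 1) / (l + 1) <= ln l <= (l - 1) (l + 5) / (4 l + 2), together
    with a Taylor polynomial as lower bound of n = exp l, reduce it to the
    positivity of one explicit polynomial in l - 1.  The case n = 2 is immediate,
    since eps 2 >= 1.

    Sharpness.  The roots of x^n - x^(n-1) + b have power sums S_m = 1 for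
    0 < m < n and S_n = 1 - n b, and l is a root when b = l^(n-1) - l^n.  For
    l = (1 + 1 / (10 n)) exp (i pi / (4 n)) and n >= 100 one has
    |1 - n b| <= 1 ([extremal_last_power_sum]), which gives c_n = 1 / 10. *)

Set Implicit Arguments.
Unset Strict Implicit.
Unset Printing Implicit Defensive.

Import Order.TTheory GRing.Theory Num.Theory.
Import numFieldNormedType.Exports.
Local Open Scope ring_scope.

(** * The modulus *)

Lemma cmod_ge0 (R : rcfType) (z : R[i]) : 0 <= cmod z.
Proof. by case: z => x y; exact: sqrtr_ge0. Qed.

Lemma cmod_gt0 (R : rcfType) (z : R[i]) : (0 < cmod z) = (z != 0).
Proof.
rewrite lt_neqAle cmod_ge0 andbT eq_sym; congr negb.
apply/eqP/eqP => [|->]; last exact: ComplexField.Normc.normc0.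
exact: ComplexField.Normc.eq0_normc.
Qed.

Lemma cmodX (R : rcfType) (z : R[i]) (m : nat) : cmod (z ^+ m) = cmod z ^+ m.
Proof.
elim: m => [|m IH]; first exact: ComplexField.Normc.normc1.
by rewrite !exprS ComplexField.Normc.normcM IH.
Qed.

Lemma cmod_nat (R : rcfType) (m : nat) : cmod (m%:R : R[i]) = m%:R.
Proof. by rewrite normcMn ComplexField.Normc.normc1. Qed.

Lemma cmod_sum_le (R : rcfType) (I : Type) (s : seq I) (P : pred I)
    (F : I -> R[i]) (G : I -> R) :
  (forall i, P i -> cmod (F i) <= G i) ->
  cmod (\sum_(i <- s | P i) F i) <= \sum_(i <- s | P i) G i.
Proof.
move=> FG; elim/big_rec2: _ => [|i y x Pi le_xy].
  by rewrite ComplexField.Normc.normc0.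
by apply: le_trans (le_normcD _ _) (lerD (FG _ Pi) le_xy).
Qed.

(** * Newton's identities *)

(** The polynomial [prod_k (1 - L k X)], whose roots are the inverses of the
    nonzero members of the family; its constant coefficient is 1. *)
Definition recip_poly (R : realType) (n : nat) (L : 'I_n -> R[i]) :
    {poly R[i]} :=
  \prod_(k < n) (1 - L k *: 'X).

Lemma recip_poly0 (R : realType) (n : nat) (L : 'I_n -> R[i]) :
  (recip_poly L)`_0 = 1.
Proof.
rewrite -horner_coef0 /recip_poly horner_prod big1 // => k _.
by rewrite !hornerE; ring.
Qed.

Lemma size_recip_poly (R : realType) (n : nat) (L : 'I_n -> R[i]) :
  (size (recip_poly L) <= n.+1)%N.
Proof.
apply: leq_trans (size_poly_prod_leq _ _) _; rewrite cardT size_enum_ord.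
have: (\sum_(k < n) size (1 - L k *: 'X)%R <= \sum_(k < n) 2)%N.
  apply: leq_sum => k _; apply: leq_trans (size_polyD _ _) _.
  rewrite size_poly1 size_polyN geq_max /=.
  by apply: leq_trans (size_scale_leq _ _) _; rewrite size_polyX.
by rewrite sum_nat_const card_ord leq_subLR addnS ltnS muln2 -addnn.
Qed.

(** Newton's identities in generating form: [- X p' / p] is the generating series
    of the power sums, so truncating the series after degree [N] leaves an error
    divisible by [X^(N+1)].  Both sides are compatible with products, which
    reduces the claim to a single factor [1 - y]. *)
Lemma newton_poly (R : realType) (n : nat) (L : 'I_n -> R[i]) (N : nat) :
  exists W : {poly R[i]},
    'X * (recip_poly L)^`() +
      (\sum_(i < N) power_sum L i.+1 *: 'X^(i.+1)) * recip_poly L = 'X^(N.+1) * W.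
Proof.
have -> : \sum_(i < N) power_sum L i.+1 *: 'X^(i.+1) =
    \sum_(k < n) \sum_(i < N) (L k *: 'X) ^+ i.+1 :> {poly R[i]}.
  rewrite exchange_big; apply: eq_bigr => i _.
  by rewrite scaler_suml; apply: eq_bigr => k _; rewrite exprZn.
rewrite /recip_poly; elim/big_ind2: _ => [|s1 p1 s2 p2 [W1 H1] [W2 H2]|k _].
- by exists 0; rewrite -polyC1 derivC !mul0r !mulr0 addr0.
- exists (W1 * p2 + p1 * W2); rewrite derivM.
  transitivity (('X * p1^`() + s1 * p1) * p2 + p1 * ('X * p2^`() + s2 * p2)).
    by ring.
  by rewrite H1 H2; ring.
exists (- (L k ^+ N.+1)%:P).
have -> : \sum_(i < N) (L k *: 'X) ^+ i.+1 =
    (L k *: 'X) * \sum_(i < N) (L k *: 'X) ^+ i :> {poly R[i]}.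
  by rewrite mulr_sumr; apply: eq_bigr => i _; rewrite exprS.
set s := \sum_(i < N) _; set y := L k *: 'X.
have hs : y ^+ N - 1 = (y - 1) * s by exact: subrX1.
have -> : y * s * (1 - y) = - y * (y ^+ N - 1) by rewrite hs; ring.
have -> : 'X^(N.+1) * - (L k ^+ N.+1)%:P = - (y * y ^+ N).
  by rewrite -exprS exprZn -mul_polyC mulrN mulrC.
have -> : (1 - y)^`() = - (L k)%:P.
  by rewrite derivB -polyC1 derivC derivZ derivX -mul_polyC mulr1 sub0r.
by rewrite /y -mul_polyC; ring.
Qed.

Lemma coef_Xderiv (R : comNzRingType) (p : {poly R}) (m : nat) :
  ('X * p^`())`_m = m%:R * p`_m.
Proof. by rewrite coefXM; case: m => [|m]; rewrite ?mul0r // coef_deriv mulr_natl. Qed.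

Lemma coef_sumZXM (R : comNzRingType) (s : nat -> R) (N : nat) (p : {poly R})
    (m : nat) :
  ((\sum_(i < N) s i *: 'X^(i.+1)) * p)`_m =
    \sum_(i < N | (i < m)%N) s i * p`_(m - i.+1).
Proof.
rewrite mulr_suml coef_sum [RHS]big_mkcond; apply: eq_bigr => i _.
by rewrite -scalerAl coefZ coefXnM; case: leqP => //; rewrite mulr0.
Qed.

Lemma newton_coef (R : realType) (n : nat) (L : 'I_n -> R[i]) (m : nat) :
  m.+1%:R * (recip_poly L)`_m.+1 =
    - \sum_(i < m.+1) power_sum L i.+1 * (recip_poly L)`_(m - i).
Proof.
have [W /(congr1 (fun p : {poly R[i]} => p`_m.+1))] := newton_poly L m.+1.
rewrite coefD coef_Xderiv (coef_sumZXM (fun i => power_sum L i.+1)).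
rewrite coefXnM ltnS leqnn => /eqP; rewrite addr_eq0 => /eqP ->; congr -%R.
by apply: eq_big => [i|i _]; rewrite ?ltn_ord ?subSS.
Qed.

(** Newton's recursion is that of the coefficients of [exp (sum_i T i X^(i+1) / (i+1))];
    if every [T i] has modulus at most 1, these are dominated by the coefficients
    of [exp (sum_i X^(i+1) / (i+1)) = 1 / (1 - X)], which are all 1. *)
Lemma newton_rec_bound (R : realType) (T c : nat -> R[i]) (N : nat) :
  cmod (c 0%N) <= 1 -> (forall i, (i < N)%N -> cmod (T i) <= 1) ->
  (forall m, (m < N)%N ->
     m.+1%:R * c m.+1 = \sum_(i < m.+1) T i * c (m - i)%N) ->
  forall m, (m <= N)%N -> cmod (c m) <= 1.
Proof.
move=> c0 T1 rec; elim/ltn_ind => -[//|m] IH mN.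
have m1 : (0 : R) < m.+1%:R by rewrite ltr0n.
rewrite -(ler_pM2l m1) mulr1 -[X in X * _]cmod_nat.
rewrite -ComplexField.Normc.normcM rec //.
have -> : m.+1%:R = \sum_(i < m.+1) 1 :> R by rewrite sumr_const card_ord.
apply: cmod_sum_le => i _; rewrite ComplexField.Normc.normcM.
have /andP[im _] : (i <= m < N)%N by rewrite -ltnS ltn_ord.
apply: mulr_ile1; rewrite ?cmod_ge0 ?T1 ?IH //; lia.
Qed.

Lemma newton_rec_exists (C : numFieldType) (T : nat -> C) :
  exists2 c : nat -> C, c 0%N = 1 &
    forall m, m.+1%:R * c m.+1 = \sum_(i < m.+1) T i * c (m - i)%N.
Proof.
pose fix g (m : nat) : nat -> C :=
  if m is m'.+1 then
    fun k => if (k <= m')%N then g m' k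
             else (\sum_(i < m'.+1) T i * g m' (m' - i)%N) / m'.+1%:R
  else fun=> 1.
have gE m k : (k <= m)%N -> g m k = g k k.
  elim: m => [|m IH]; first by rewrite leqn0 => /eqP ->.
  by rewrite leq_eqVlt => /predU1P[-> //|km]; rewrite /= -ltnS km IH.
exists (fun k => g k k) => // m; rewrite /= ltnn mulrC divfK ?pnatr_eq0 //.
by apply: eq_bigr => i _; rewrite gE ?leq_subr.
Qed.

Lemma cmod_recip_poly_coef (R : realType) (n : nat) (L : 'I_n -> R[i]) (m : nat) :
  power_sums_le L 1 -> cmod (recip_poly L)`_m <= 1.
Proof.
move=> SL; have [mn|nm] := leqP m n; last first.
  rewrite nth_default ?ComplexField.Normc.normc0 //.
  exact: leq_trans (size_recip_poly L) nm.
apply: (@newton_rec_bound _ (fun i => - power_sum L i.+1)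
   (fun i => (recip_poly L)`_i) n) => // [|i iN|k kn].
- by rewrite recip_poly0 ComplexField.Normc.normc1.
- by rewrite normcN (le_trans (SL i.+1 _)) ?expr1n.
by rewrite newton_coef -sumrN; apply: eq_bigr => i _; rewrite mulNr.
Qed.

(** A zero [z] of [p = recip_poly L] annihilates [p q], where [q] is the
    truncation at degree [N] of the exponential of the first [n] power sums.  The
    coefficients of [p q] in degrees [1..n] vanish, those in degrees [n+1..N]
    satisfy [|c_k| <= n (k - n) / k], and those beyond [N], which are due to the
    truncation of [q], are at most [n + 1]. *)
Lemma recip_poly_root_ineq (R : realType) (n : nat) (L : 'I_n -> R[i])
    (z : R[i]) (N : nat) :
  power_sums_le L 1 -> root (recip_poly L) z -> (n <= N)%N ->
  1 <= \sum_(n <= k < N) n%:R * (k.+1 - n)%:R / k.+1%:R * cmod z ^+ k.+1 +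
       \sum_(N <= k < N + n) n.+1%:R * cmod z ^+ k.+1 :> R.
Proof.
move=> SL /rootP z0 nN; set p := recip_poly L in z0 *.
pose T i := if (i < n)%N then power_sum L i.+1 else 0.
have T1 i : cmod (T i) <= 1.
  rewrite /T; case: ifP => [iN|_]; last by rewrite ComplexField.Normc.normc0.
  by rewrite (le_trans (SL i.+1 _)) ?expr1n.
have p1 i : cmod p`_i <= 1 by exact: cmod_recip_poly_coef.
have [h h0 hrec] := newton_rec_exists T.
have h1 i : cmod (h i) <= 1.
  apply: (@newton_rec_bound _ T h i) => //.
  by rewrite h0 ComplexField.Normc.normc1.
pose q := \poly_(i < N.+1) h i.
have q1 i : cmod q`_i <= 1.
  by rewrite coef_poly; case: ifP => _ //; rewrite ComplexField.Normc.normc0.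
(* Only the coefficients of degree at most N matter below *)
pose s : {poly R[i]} := \sum_(i < N) T i *: 'X^(i.+1).
(* [p] and [q] have opposite logarithmic derivatives, up to the errors [Q], [E] *)
pose Q := 'X * p^`() + s * p; pose E := 'X * q^`() - s * q.
have Xpq : 'X * (p * q)^`() = Q * q + p * E.
  by rewrite derivM /Q /E; ring.
have s0 (f : {poly R[i]}) : (s * f)`_0 = 0.
  by rewrite /s coef_sumZXM big_pred0.
have sS m (f : {poly R[i]}) : (m < N)%N ->
    (s * f)`_m.+1 = \sum_(i < m.+1) T i * f`_(m - i).
  move=> mN; rewrite /s coef_sumZXM.
  rewrite (big_ord_widen N (fun i => T i * f`_(m - i))) //.
have E0 k : (k <= N)%N -> E`_k = 0.
  rewrite /E coefB coef_Xderiv; case: k => [_|m mN].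
    by rewrite mul0r s0 subrr.
  rewrite sS // coef_poly ltnS mN hrec; apply/eqP; rewrite subr_eq0; apply/eqP.
  by apply: eq_bigr => i _; rewrite coef_poly ltnS (leq_trans (leq_subr _ _)) // ltnW.
have Q1 j : (j <= N)%N -> cmod Q`_j <= (if (n < j)%N then n%:R else 0).
  rewrite /Q coefD coef_Xderiv; case: j => [_|m mN].
    by rewrite mul0r s0 addr0 ComplexField.Normc.normc0.
  rewrite sS // ltnS; case: leqP => [nm|mn].
    rewrite (@nth_default _ _ p) ?mulr0 ?add0r; last first.
      by apply: leq_trans (size_recip_poly L) _.
    have -> : n%:R = \sum_(i < m.+1) (if (i < n)%N then 1 else 0) :> R.
      rewrite -big_mkcond -(big_ord_widen _ (fun=> 1)); last exact: leqW.
      by rewrite sumr_const card_ord.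
    apply: cmod_sum_le => i _; rewrite ComplexField.Normc.normcM /T.
    case: ifP => [iN|_]; last by rewrite ComplexField.Normc.normc0 mul0r.
    by rewrite mulr_ile1 ?cmod_ge0 ?p1 // (le_trans (SL i.+1 _)) ?expr1n.
  rewrite newton_coef addrC (_ : _ - _ = 0) ?ComplexField.Normc.normc0 //.
  apply/eqP; rewrite subr_eq0; apply/eqP; apply: eq_bigr => i _.
  by rewrite /T ifT //; have := ltn_ord i; lia.
have pq0 : (p * q)`_0 = 1.
  by rewrite coef0M /p recip_poly0 coef_poly /= h0 mulr1.
(* The coefficients of [Q] vanish up to degree [n] and are at most [n] beyond *)
have pqS m : (m < N)%N -> cmod (p * q)`_m.+1 <= n%:R * (m.+1 - n)%:R / m.+1%:R.
  move=> mN; rewrite ler_pdivlMr ?ltr0n // mulrC -[X in X * _]cmod_nat.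
  rewrite -ComplexField.Normc.normcM -coef_Xderiv Xpq coefD [X in _ + X]coefM.
  rewrite [X in _ + X]big1 ?addr0; last first.
    by move=> j _; rewrite E0 ?mulr0 //; lia.
  have -> : n%:R * (m.+1 - n)%:R =
      \sum_(j < m.+2) (if (n < j)%N then n%:R else 0) :> R.
    rewrite -(big_mkord xpredT (fun j => if (n < j)%N then n%:R else 0)).
    have [nm|mn] := ltnP n m.+2; last first.
      rewrite big_nat big1 => [|j jm]; last by rewrite ifN //; lia.
      by rewrite (eqP (_ : m.+1 - n == 0)%N) ?mulr0 //; lia.
    rewrite (@big_cat_nat _ _ _ n.+1) //= big_nat big1 => [|j jm]; last first.
      by rewrite ifN //; lia.
    rewrite add0r (@eq_big_nat _ _ _ _ _ _ (fun=> n%:R)) => [|j jm]; last first.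
      by rewrite ifT //; lia.
    by rewrite sumr_const_nat subSS mulr_natr.
  rewrite coefM; apply: cmod_sum_le => j _.
  rewrite ComplexField.Normc.normcM.
  have jN : (j <= N)%N by have := ltn_ord j; lia.
  by apply: le_trans (Q1 j jN); rewrite ler_piMr ?cmod_ge0.
have pqN k : cmod (p * q)`_k <= n.+1%:R.
  have -> : (p * q)`_k = \sum_(i < n.+1) if (i <= k)%N then p`_i * q`_(k - i) else 0.
    have {1}-> : p = \sum_(i < n.+1) p`_i *: 'X^i.
      by rewrite -poly_def; apply/polyP => i; rewrite coef_poly; case: leqP => // ?;
        rewrite nth_default //; apply: leq_trans (size_recip_poly L) _.
    rewrite mulr_suml coef_sum; apply: eq_bigr => i _.
    by rewrite -scalerAl coefZ coefXnM; case: leqP => //; rewrite mulr0.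
  have -> : n.+1%:R = \sum_(i < n.+1) 1 :> R by rewrite sumr_const card_ord.
  apply: cmod_sum_le => i _; case: ifP => _.
    by rewrite ComplexField.Normc.normcM mulr_ile1 ?cmod_ge0.
  by rewrite ComplexField.Normc.normc0.
have size_pq : (size (p * q)%R <= (N + n).+1)%N.
  have sp : (size p <= n.+1)%N := size_recip_poly L.
  have sq : (size q <= N.+1)%N := size_poly _ _.
  move: (size_polyMleq p q) sp sq.
  by move: (size _) (size _) (size _) => a b c; lia.
have : (p * q).[z] = 0 by rewrite hornerM z0 mul0r.
rewrite (horner_coef_wide _ size_pq) big_ord_recl /= pq0 expr0 mulr1.
move/eqP; rewrite addr_eq0 => /eqP h1E.
rewrite -[leLHS](ComplexField.Normc.normc1 R) h1E normcN.
pose G k : R :=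
  if (k < n)%N then 0
  else if (k < N)%N then n%:R * (k.+1 - n)%:R / k.+1%:R * cmod z ^+ k.+1
  else n.+1%:R * cmod z ^+ k.+1.
apply: le_trans (_ : \sum_(0 <= k < N + n) G k <= _).
  rewrite big_mkord; apply: cmod_sum_le => k _.
  rewrite ComplexField.Normc.normcM cmodX /G /bump /= add1n.
  have z_ge0 := exprn_ge0 k.+1 (cmod_ge0 z).
  case: ltnP => [kn|nk]; last first.
    by case: ltnP => [kN|_]; rewrite ler_wpM2r ?pqS ?pqN.
  have := pqS k (leq_trans kn nN).
  rewrite (eqP (_ : k.+1 - n == 0)%N); last by lia.
  rewrite mulr0 mul0r => le0; rewrite (_ : cmod _ = 0) ?mul0r //.
  by apply/eqP; rewrite eq_le le0 cmod_ge0.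
rewrite (@big_cat_nat _ _ _ n) ?leq_addl //= big_nat big1 => [|k kn]; last first.
  by rewrite /G ifT //; case/andP: kn.
rewrite add0r (@big_cat_nat _ _ _ N) ?leq_addr //= lerD //.
  rewrite [leRHS]big_nat big_nat; apply: ler_sum => k /andP[nk kN].
  by rewrite /G ltnNge nk kN.
rewrite [leRHS]big_nat big_nat; apply: ler_sum => k /andP[nk kN].
by rewrite /G !ltnNge nk (leq_trans nN nk).
Qed.

(** * The critical inequality *)

Lemma bernoulli_ineq (R : realDomainType) (x : R) (N : nat) :
  0 <= x -> 1 + N%:R * x <= (1 + x) ^+ N.
Proof.
move=> x0; elim: N => [|N IH]; first by rewrite mul0r addr0 expr0.
rewrite exprS -natr1; apply: le_trans (_ : (1 + x) * (1 + N%:R * x) <= _).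
  have : 0 <= N%:R * x * x by rewrite !mulr_ge0.
  by lra.
by rewrite ler_wpM2l // addr_ge0.
Qed.

Lemma sum_geo (R : realFieldType) (d : R) (M : nat) : 0 < d ->
  \sum_(0 <= i < M) (1 + d)^-1 ^+ i.+1 = (1 - (1 + d)^-1 ^+ M) / d.
Proof.
move=> d0; have d1 : 1 + d != 0 by rewrite gt_eqF // addr_gt0.
elim: M => [|M IH]; first by rewrite big_geq // expr0 subrr mul0r.
rewrite big_nat_recr //= IH !exprS; field.
by rewrite d1 gt_eqF.
Qed.

Lemma sum_arith_geo (R : realFieldType) (d : R) (M : nat) : 0 < d ->
  \sum_(0 <= i < M) i.+1%:R * (1 + d)^-1 ^+ i.+1 =
    (1 + d) / d ^+ 2 - (1 + d)^-1 ^+ M * (M%:R / d + (1 + d) / d ^+ 2).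
Proof.
move=> d0; have d1 : 1 + d != 0 by rewrite gt_eqF // addr_gt0.
elim: M => [|M IH].
  by rewrite big_geq // expr0 mul0r add0r mul1r subrr.
rewrite big_nat_recr //= IH !exprS -natr1; field.
by rewrite d1 gt_eqF.
Qed.

(** The concave function [x / (n + x)] lies below its tangent at [P]. *)
Lemma frac_tangent (R : realFieldType) (n x P : R) :
  0 < n -> 0 <= x -> 0 < P ->
  n * x / (n + x) <= n * (P ^+ 2 + n * x) / (n + P) ^+ 2.
Proof.
move=> n0 x0 P0; have nx : 0 < n + x by lra. have nP : 0 < n + P by lra.
rewrite ler_pdivrMr // mulrAC ler_pdivlMr ?exprn_gt0 // -subr_ge0.
have -> : n * (P ^+ 2 + n * x) * (n + x) - n * x * (n + P) ^+ 2 =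
  n ^+ 2 * (x - P) ^+ 2 by ring.
by rewrite mulr_ge0 ?sqr_ge0.
Qed.

Lemma le_of_geometric_error (R : archiRealFieldType) (a b c d : R) (n : nat) :
  0 < d -> 0 <= c ->
  (forall N, (n <= N)%N -> a <= b + c * (1 + d)^-1 ^+ N) -> a <= b.
Proof.
move=> d0 c0 H; rewrite leNgt; apply/negP => ba.
have e0 : 0 < (a - b) * d by rewrite mulr_gt0 // subr_gt0.
pose N := maxn n (Num.bound (c / ((a - b) * d))).
have := H N (leq_maxl _ _).
have d1 : 0 < (1 + d) ^+ N by rewrite exprn_gt0 // addr_gt0.
rewrite exprVn -lerBlDl ler_pdivlMr //; apply/negP; rewrite -ltNge.
have ab : 0 < a - b by rewrite subr_gt0.
apply: lt_le_trans (_ : (a - b) * (1 + N%:R * d) <= _); last first.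
  by rewrite ler_wpM2l ?bernoulli_ineq // ltW.
have cN : c < N%:R * ((a - b) * d).
  rewrite -ltr_pdivrMr //; apply: lt_le_trans (archi_boundP _) _.
    by rewrite divr_ge0 // ltW.
  by rewrite ler_nat leq_maxr.
by lra.
Qed.

(** Summation of the inequality of [recip_poly_root_ineq], with [|z| = 1 / (1 + d)],
    in the limit [N] to infinity. *)
Lemma critical_ineq (R : archiRealFieldType) (n : nat) (d : R) :
  (0 < n)%N -> 0 < d ->
  (forall N, (n <= N)%N ->
     1 <= \sum_(n <= k < N) n%:R * (k.+1 - n)%:R / k.+1%:R * (1 + d)^-1 ^+ k.+1 +
          \sum_(N <= k < N + n) n.+1%:R * (1 + d)^-1 ^+ k.+1) ->
  d * (1 + d) ^+ n * (n.+1%:R * d + 1) <= n%:R * (1 + d).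
Proof.
move=> n0 d0 H; set r := (1 + d)^-1 in H.
have d1 : 0 < 1 + d by lra.
have nR : 0 < n%:R :> R by rewrite ltr0n.
have r0 : 0 < r by rewrite invr_gt0.
(* The mean of [x >= 1] for the geometric weights [r^x]: the best tangent point *)
pose P := (1 + d) / d; have P0 : 0 < P by rewrite divr_gt0.
have geo_le M : \sum_(0 <= i < M) r ^+ i.+1 <= d^-1.
  rewrite sum_geo // ler_pdivrMr // mulVf ?gt_eqF //.
  by have := exprn_gt0 M r0; rewrite /r; lra.
have arith_le M : \sum_(0 <= i < M) i.+1%:R * r ^+ i.+1 <= (1 + d) / d ^+ 2.
  rewrite sum_arith_geo // gerBl mulr_ge0 ?exprn_ge0 ?(ltW r0) //.
  by rewrite addr_ge0 // divr_ge0 ?exprn_ge0 ?ler0n // ltW.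
have tail N : \sum_(N <= k < N + n) n.+1%:R * r ^+ k.+1 <= n.+1%:R / d * r ^+ N.
  rewrite -{1}(add0n N) (addnC N) big_addn addnK.
  rewrite (eq_bigr (fun i => n.+1%:R * r ^+ N * r ^+ i.+1)) => [|i _]; last first.
    by rewrite -addSn addnC exprD mulrA.
  by rewrite -mulr_sumr [leRHS]mulrAC ler_wpM2l // mulr_ge0 ?exprn_ge0 ?ler0n // ltW.
pose B := n%:R * r ^+ n * P / (d * (n%:R + P)).
have nP : 0 < n%:R + P by rewrite addr_gt0.
have main N : (n <= N)%N ->
   \sum_(n <= k < N) n%:R * (k.+1 - n)%:R / k.+1%:R * r ^+ k.+1 <= B.
  move=> nN; rewrite -{1}(add0n n) big_addn.
  pose K := n%:R * r ^+ n / (n%:R + P) ^+ 2.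
  have K0 : 0 <= K by rewrite divr_ge0 ?mulr_ge0 ?exprn_ge0 ?ler0n ?ltW.
  apply: le_trans (_ : \sum_(0 <= i < N - n)
     K * (P ^+ 2 * r ^+ i.+1 + n%:R * (i.+1%:R * r ^+ i.+1)) <= _).
    apply: ler_sum => i _; rewrite -addSn addnK natrD exprD (addrC i.+1%:R).
    have := @frac_tangent R n%:R i.+1%:R P nR (ler0n _ _) P0.
    have rr : 0 <= r ^+ i.+1 * r ^+ n by rewrite -exprD exprn_ge0 // ltW.
    move=> /(ler_wpM2r rr) /le_trans; apply; rewrite /K.
    by rewrite le_eqVlt; apply/orP; left; apply/eqP; field; rewrite gt_eqF.
  rewrite -mulr_sumr big_split /= -!mulr_sumr.
  apply: le_trans (_ : K * (P ^+ 2 * d^-1 + n%:R * ((1 + d) / d ^+ 2)) <= _).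
    by rewrite ler_wpM2l // lerD // ler_wpM2l // ?exprn_ge0 ?ler0n // ltW.
  rewrite /K /B /P le_eqVlt; apply/orP; left; apply/eqP; field.
  by apply/andP; split; rewrite gt_eqF // addr_gt0 // mulr_gt0.
have : 1 <= B.
  apply: (@le_of_geometric_error _ _ _ (n.+1%:R / d) d n) => // [|N nN].
    by rewrite divr_ge0 ?ler0n // ltW.
  exact: le_trans (H N nN) (lerD (main N nN) (tail N)).
rewrite /B ler_pdivlMr ?mulr_gt0 // mul1r /P /r exprVn.
have dn : 0 < (1 + d) ^+ n by rewrite exprn_gt0.
rewrite -(ler_pM2r dn) -(ler_pM2r d0).
rewrite (_ : n%:R / _ * _ * _ * _ = n%:R * (1 + d)); last first.
  by field; rewrite !gt_eqF.
rewrite -natr1; apply: le_trans; rewrite le_eqVlt; apply/orP; left; apply/eqP.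
by field; rewrite gt_eqF.
Qed.

(** * Rational bounds for the logarithm and the exponential *)

Lemma ge0_of_derive_ge0 (R : realType) (f df : R -> R) (a : R) :
  (forall x, a <= x -> is_derive x 1 f (df x)) ->
  (forall x, a <= x -> 0 <= df x) -> 0 <= f a ->
  forall x, a <= x -> 0 <= f x.
Proof.
move=> fd df0 fa x ax.
have [||c] := @MVT_segment R f df a x ax.
- by move=> y; rewrite in_itv /= => /andP[/ltW ay _]; exact: fd.
- apply: derivable_within_continuous => y; rewrite in_itv /= => /andP[ay _].
  by have := fd y ay => -[].
rewrite in_itv /= => /andP[ac _] fE.
have : 0 <= df c * (x - a) by rewrite mulr_ge0 ?df0 // subr_ge0.
by rewrite -fE; lra.
Qed.

Lemma ln_le_sub1 (R : realType) (x : R) : 0 < x -> ln x <= x - 1.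
Proof.
move=> x0; have := @le_ln1Dx R (x - 1); rewrite addrCA subrr addr0; apply.
by lra.
Qed.

Lemma ln_ge_pade (R : realType) (x : R) :
  1 <= x -> 2 * (x - 1) / (x + 1) <= ln x.
Proof.
move=> x1; rewrite ler_pdivrMr -1?subr_ge0; last by lra.
move: x x1; apply: (@ge0_of_derive_ge0 _ _ (fun x => ln x + x^-1 - 1)).
- move=> x x1; have x0 : 0 < x by lra.
  have dX := is_derive_id x (1 : R); have dC c := is_derive_cst (c : R) x (1 : R).
  apply: (is_derive_eq (is_deriveB
    (is_deriveM (is_derive1_ln x0) (is_deriveD dX (dC 1)))
    (is_deriveM (dC 2) (is_deriveB dX (dC 1))))).
  by rewrite /GRing.scale /= !fctE; field; rewrite gt_eqF.
- move=> x x1; have x0 : 0 < x by lra.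
  have xi : 0 < x^-1 by rewrite invr_gt0.
  by have := ln_le_sub1 xi; rewrite lnV //; lra.
by rewrite ln1 subrr; lra.
Qed.

Lemma ln_le_half (R : realType) (x : R) : 1 <= x -> 2 * x * ln x <= x ^+ 2 - 1.
Proof.
move=> x1; rewrite -subr_ge0.
move: x x1; apply: (@ge0_of_derive_ge0 _ _ (fun x => 2 * (x - 1 - ln x))).
- move=> x x1; have x0 : 0 < x by lra.
  have dX := is_derive_id x (1 : R); have dC c := is_derive_cst (c : R) x (1 : R).
  apply: (is_derive_eq (is_deriveB
    (is_deriveB (is_deriveM dX dX) (dC 1))
    (is_deriveM (is_deriveM (dC 2) dX) (is_derive1_ln x0)))).
  by rewrite /GRing.scale /= !fctE; field; rewrite gt_eqF.
- move=> x x1; have x0 : 0 < x by lra.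
  by have := ln_le_sub1 x0; lra.
by rewrite ln1; lra.
Qed.

Lemma ln_le_pade (R : realType) (x : R) :
  1 <= x -> ln x <= (x - 1) * (x + 5) / (4 * x + 2).
Proof.
move=> x1; rewrite ler_pdivlMr -1?subr_ge0; last by lra.
move: x x1.
apply: (@ge0_of_derive_ge0 _ _ (fun x => 2 * (x ^+ 2 - 1 - 2 * x * ln x) / x)).
- move=> x x1; have x0 : 0 < x by lra.
  have dX := is_derive_id x (1 : R); have dC c := is_derive_cst (c : R) x (1 : R).
  apply: (is_derive_eq (is_deriveB
    (is_deriveM (is_deriveB dX (dC 1)) (is_deriveD dX (dC 5)))
    (is_deriveM (is_derive1_ln x0) (is_deriveD (is_deriveM (dC 4) dX) (dC 2))))).
  by rewrite /GRing.scale /= !fctE; field; rewrite gt_eqF.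
- move=> x x1; have x0 : 0 < x by lra.
  by rewrite divr_ge0 ?(ltW x0) // mulr_ge0 // subr_ge0 ln_le_half.
by rewrite ln1; lra.
Qed.

Lemma expR_ge_taylor (R : realType) (x : R) (n : nat) :
  0 <= x -> \sum_(0 <= i < n) x ^+ i / i`!%:R <= expR x.
Proof.
move=> x0; rewrite /expR.
apply: (@nondecreasing_cvgn_le _ (series (exp_coeff x))).
  apply: nondecreasing_series => i _ _; rewrite /exp_coeff /=.
  by rewrite divr_ge0 ?exprn_ge0.
exact: is_cvg_series_exp_coeff.
Qed.

(** In terms of [t = l - 1], the difference of the two sides is nondecreasing in
    [n], and at [n] equal to the Taylor polynomial of degree 6 of [expR l] it is
    a polynomial in [t], positive for [t >= 0], over a positive denominator. *)
Lemma rational_ineq (R : realFieldType) (l a b n : R) :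
  1 <= l ->
  a = (3 * l ^+ 2 - 2 * l + 5) / (4 * l + 2) ->
  b = (l ^+ 2 - l + 2) / (l + 1) ->
  \sum_(0 <= i < 7) l ^+ i / i`!%:R <= n ->
  l ^+ 2 * (n + 2 * b + b ^+ 2) <= (4 * a ^+ 2 + 2 * a) * (n - b ^+ 2).
Proof.
move=> l1 aE bE; set T := \sum_(_ <= _ < _) _ => Tn.
have TE : T = 1 + l + l ^+ 2 / 2 + l ^+ 3 / 6 + l ^+ 4 / 24 + l ^+ 5 / 120 +
              l ^+ 6 / 720.
  rewrite /T !big_nat_recr //= big_geq // !factS fact0 expr0 expr1 /=.
  by rewrite !muln1; field.
pose t := l - 1; have t0 : 0 <= t by rewrite subr_ge0.
have lE : l = 1 + t by rewrite /t; ring.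
have d1 : 0 < 4 * t + 6 by lra. have d2 : 0 < t + 2 by lra.
have slope : 4 * a ^+ 2 + 2 * a - l ^+ 2 =
    (20 * t ^+ 4 + 40 * t ^+ 3 + 128 * t ^+ 2 + 168 * t + 180) / (4 * t + 6) ^+ 2.
  rewrite aE lE; field.
  by rewrite gt_eqF //=; lra.
have slope_ge0 : 0 <= 4 * a ^+ 2 + 2 * a - l ^+ 2.
  by rewrite slope divr_ge0 ?sqr_ge0 // !addr_ge0 // mulr_ge0 // exprn_ge0.
(* The two squares absorb the negative coefficients, in degrees 4 and 5 *)
pose P := 661 + (1851 + 8 / 15) * t +
    (1277 + 11 / 72) * t ^+ 2 +
    (498 + 7 / 10) * t ^+ 3 +
    (3 + 179 / 180) * t ^+ 4 +
    (14 + 28 / 45) * t ^+ 5 +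
    14 / 45 * t ^+ 6 + 5 / 9 * t ^+ 7 +
    78 * t ^+ 2 * (t ^+ 2 - 7 / 4) ^+ 2 +
    156 * t ^+ 3 * (t ^+ 2 - 1 / 2) ^+ 2 +
    (82 + 29 / 45) * t ^+ 8 + (28 + 31 / 45) * t ^+ 9 +
    (4 + 107 / 180) * t ^+ 10 + 1 / 2 * t ^+ 11 + 1 / 36 * t ^+ 12.
have P0 : 0 <= P.
  have tn k : 0 <= t ^+ k by rewrite exprn_ge0.
  have sq1 := mulr_ge0 (tn 2%N) (sqr_ge0 (t ^+ 2 - 7 / 4)).
  have sq2 := mulr_ge0 (tn 3%N) (sqr_ge0 (t ^+ 2 - 1 / 2)).
  move: (tn 2%N) (tn 3%N) (tn 4%N) (tn 5%N) (tn 6%N) (tn 7%N) (tn 8%N).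
  by move: (tn 9%N) (tn 10%N) (tn 11%N) (tn 12%N); rewrite /P; lra.
have at_T : (4 * a ^+ 2 + 2 * a) * (T - b ^+ 2) - l ^+ 2 * (T + 2 * b + b ^+ 2) =
    P / ((4 * t + 6) ^+ 2 * (t + 2) ^+ 2).
  rewrite TE aE bE lE /P; field.
  by rewrite !gt_eqF //=; lra.
have : 0 <= (4 * a ^+ 2 + 2 * a) * (T - b ^+ 2) - l ^+ 2 * (T + 2 * b + b ^+ 2).
  by rewrite at_T divr_ge0 // mulr_ge0 ?sqr_ge0.
have : 0 <= (4 * a ^+ 2 + 2 * a - l ^+ 2) * (n - T) by rewrite mulr_ge0 // subr_ge0.
by lra.
Qed.

Lemma expRN_ge_pade (R : realType) (x : R) :
  0 <= x -> (2 - x) / (2 + x) <= expR (- x).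
Proof.
move=> x0; have y1 : 1 <= expR x by have := expR_ge1Dx x; lra.
have := ln_ge_pade y1; rewrite expRK expRN.
rewrite ler_pdivrMr => [H|]; last by lra.
rewrite ler_pdivrMr; last by lra.
by rewrite mulrC ler_pdivlMr ?expR_gt0 //; lra.
Qed.

Lemma ln3_gt1 (R : realType) : 1 < ln (3 : R).
Proof.
have -> : (3 : R) = 3 / 2 * 2 by field.
rewrite lnM ?posrE //; last by lra.
have := @ln_ge_pade R (3 / 2) ltac:(lra); have := @ln_ge_pade R 2 ltac:(lra).
have -> : 2 * (2 - 1) / (2 + 1) = 2 / 3 :> R by field.
have -> : 2 * (3 / 2 - 1) / (3 / 2 + 1) = 2 / 5 :> R by field.
lra.
Qed.

(** * The critical inequality fails at eps *)

Lemma eps_gt0 (R : realType) (n : nat) : (2 <= n)%N -> 0 < eps R n.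
Proof.
move=> n2; have L0 : 0 < ln (n%:R : R) by rewrite ln_gt0 // ltr1n.
rewrite divr_gt0 ?ltr0n ?(ltn_trans _ n2) // mulr_gt0 //.
by have := ln_le_sub1 L0; lra.
Qed.

Lemma eps_supercritical_ge3 (R : realType) (n : nat) (d := eps R n) :
  (3 <= n)%N ->
  n%:R * (1 + d) <= d * (1 + d) ^+ n * (n.+1%:R * d + 1).
Proof.
move=> n3; pose L := ln (n%:R : R); pose u := L - ln L.
have n0 : (0 : R) < n%:R by rewrite ltr0n; lia.
have L1 : 1 < L.
  apply: lt_le_trans (ln3_gt1 R) _; rewrite ler_ln ?posrE // ?ler_nat //.
have nS : n.-1.+1 = n by apply: prednK; lia.
have nE : expR L = n%:R by rewrite /L lnK // posrE.
have L0 : 0 < L by lra.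
have [a aE] : exists a, a = (3 * L ^+ 2 - 2 * L + 5) / (4 * L + 2) by eexists.
have [b bE] : exists b, b = (L ^+ 2 - L + 2) / (L + 1) by eexists.
have au : a <= u.
  have := ln_le_pade (ltW L1); rewrite /u.
  rewrite (_ : _ / _ = L - a); first by lra.
  by rewrite aE; field; rewrite gt_eqF //; lra.
have ub : u <= b.
  have := ln_ge_pade (ltW L1); rewrite /u.
  rewrite (_ : _ / _ = L - b); first by lra.
  by rewrite bE; field; rewrite gt_eqF //; lra.
have a0 : 0 < a.
  rewrite aE divr_gt0 //; last by lra.
  have := sqr_ge0 (L - 1); lra.
have u0 : 0 < u by lra.
have Tn : \sum_(0 <= i < 7) L ^+ i / i`!%:R <= n%:R :> R.
  by rewrite -nE; exact/expR_ge_taylor/ltW.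
have key : L ^+ 2 * (n%:R + 2 * u + u ^+ 2) <= 2 * u * (2 * u + 1) * (n%:R - u ^+ 2).
  have key := rational_ineq (ltW L1) aE bE Tn.
  have ub2 : u ^+ 2 <= b ^+ 2 by apply: lerXn2r; rewrite ?nnegrE; lra.
  have au2 : a ^+ 2 <= u ^+ 2 by apply: lerXn2r; rewrite ?nnegrE; lra.
  have L2 : 0 < L ^+ 2 by rewrite exprn_gt0.
  have b2 := sqr_ge0 b.
  have nb : 0 <= n%:R - b ^+ 2.
    rewrite leNgt; apply/negP => nb.
    have : (4 * a ^+ 2 + 2 * a) * (n%:R - b ^+ 2) <= 0.
      rewrite mulr_ge0_le0 //; [have := sqr_ge0 a; lra | exact: ltW].
    have : 0 < L ^+ 2 * (n%:R + 2 * b + b ^+ 2) by rewrite mulr_gt0 //; lra.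
    lra.
  apply: le_trans (_ : L ^+ 2 * (n%:R + 2 * b + b ^+ 2) <= _).
    rewrite ler_pM2l //; lra.
  apply: le_trans key _.
  apply: le_trans (_ : (4 * u ^+ 2 + 2 * u) * (n%:R - b ^+ 2) <= _).
    by rewrite ler_wpM2r //; lra.
  rewrite (_ : 2 * u * (2 * u + 1) = 4 * u ^+ 2 + 2 * u); last by ring.
  rewrite ler_wpM2l //; last lra.
  have := sqr_ge0 u; lra.
have dE : d = 2 * u / n%:R by [].
have d0 : 0 < d by rewrite dE divr_gt0 // mulr_gt0.
have d1 : 0 < 1 + d by lra.
(* [(n - 1) * 2 d / (2 + d) = 2 u - x] *)
pose x := 2 * u * (1 + u) / (n%:R + u).
have nu : 0 < n%:R + u by lra.
have x0 : 0 <= x by rewrite divr_ge0 ?mulr_ge0 // ltW //; lra.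
have pow : n%:R ^+ 2 / L ^+ 2 * ((2 - x) / (2 + x)) <= (1 + d) ^+ n.-1.
  have -> : n%:R ^+ 2 / L ^+ 2 = expR (2 * u).
    by rewrite /u mulrBr expRB !expRM_natl nE lnK // posrE.
  have -> : (1 + d) ^+ n.-1 = expR (n.-1%:R * ln (1 + d)).
    by rewrite expRM_natl lnK // posrE.
  apply: le_trans (_ : expR (2 * u - x) <= _).
    by rewrite expRD ler_wpM2l ?expR_ge0 // expRN_ge_pade.
  have d11 : 1 <= 1 + d by lra.
  rewrite ler_expR; apply: le_trans (_ : n.-1%:R * (2 * (1 + d - 1) / (1 + d + 1)) <= _).
    rewrite le_eqVlt; apply/orP; left; apply/eqP.
    have -> : n.-1%:R = n%:R - 1 :> R by rewrite -[in RHS]nS -natr1 addrK.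
    rewrite /x dE; field.
    by apply/and3P; split; rewrite gt_eqF //; lra.
  by rewrite ler_wpM2l ?ln_ge_pade.
have -> : (1 + d) ^+ n = (1 + d) * (1 + d) ^+ n.-1.
  by rewrite -exprS nS.
rewrite (mulrC n%:R) mulrCA -mulrA ler_pM2l //.
apply: le_trans (_ : d * (n%:R ^+ 2 / L ^+ 2 * ((2 - x) / (2 + x))) * (2 * u + 1) <= _).
  rewrite -subr_ge0.
  have -> : d * (n%:R ^+ 2 / L ^+ 2 * ((2 - x) / (2 + x))) * (2 * u + 1) - n%:R =
    n%:R / (L ^+ 2 * (n%:R + 2 * u + u ^+ 2)) *
    (2 * u * (2 * u + 1) * (n%:R - u ^+ 2) - L ^+ 2 * (n%:R + 2 * u + u ^+ 2)).
    rewrite dE /x; field.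
    have u2 : 0 < u * u by rewrite mulr_gt0.
    have q1 : 0 < n%:R + 2 * u + u ^+ 2 by rewrite expr2; lra.
    have q2 : 0 < 2 * (n%:R + u) + 2 * u * (1 + u) by lra.
    by rewrite !gt_eqF.
  rewrite mulr_ge0 ?subr_ge0 // divr_ge0 ?ltW //.
  by rewrite mulr_gt0 ?exprn_gt0 //; have := sqr_ge0 u; lra.
apply: le_trans (_ : d * (1 + d) ^+ n.-1 * (2 * u + 1) <= _).
  rewrite ler_wpM2r //; first by lra.
  by rewrite ler_wpM2l // ltW.
rewrite ler_wpM2l //; first by rewrite mulr_ge0 ?exprn_ge0 // ltW.
have -> : n.+1%:R * d = 2 * u + d by rewrite -natr1 dE; field; rewrite gt_eqF.
lra.
Qed.

Lemma eps_supercritical (R : realType) (n : nat) (d := eps R n) :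
  (2 <= n)%N -> n%:R * (1 + d) <= d * (1 + d) ^+ n * (n.+1%:R * d + 1).
Proof.
rewrite /d leq_eqVlt => /predU1P[<-|]; last exact: eps_supercritical_ge3.
have : 1 <= eps R 2.
  have L0 : 0 < ln (2 : R) by rewrite ln_gt0 // ltr1n.
  rewrite /eps (_ : 2 * _ / 2 = ln 2 - ln (ln 2)); last by field.
  by have := ln_le_sub1 L0; lra.
move: (eps R 2) => e e1.
have e2 : 1 * 1 <= e * (1 + e) by apply: ler_pM; lra.
have : 1 * 4 <= (e * (1 + e)) * (3 * e + 1) by apply: ler_pM; lra.
move=> e3; rewrite (_ : e * _ * _ = (1 + e) * (e * (1 + e) * (3 * e + 1))).
  by rewrite mulrC ler_wpM2l; lra.
by ring.
Qed.

(** After division by [1 + d], the left side of the critical inequality increases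
    with [d] while the right side is constant. *)
Lemma subcritical_le (R : realFieldType) (n : nat) (d e : R) :
  (0 < n)%N -> 0 < d -> 0 < e ->
  d * (1 + d) ^+ n * (n.+1%:R * d + 1) <= n%:R * (1 + d) ->
  n%:R * (1 + e) <= e * (1 + e) ^+ n * (n.+1%:R * e + 1) -> d <= e.
Proof.
case: n => // m _ d0 e0 Hd He; rewrite leNgt; apply/negP => ed.
have simp (x : R) :
    x * (1 + x) ^+ m.+1 * (m.+2%:R * x + 1) =
    (1 + x) * (x * (m.+2%:R * x + 1) * (1 + x) ^+ m).
  by rewrite exprS; ring.
have d1 : 0 < 1 + d by lra. have e1 : 0 < 1 + e by lra.
rewrite simp (mulrC m.+1%:R) ler_pM2l // in Hd.
rewrite simp (mulrC m.+1%:R) ler_pM2l // in He.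
have := le_trans Hd He; apply/negP; rewrite -ltNge.
have m0 : 0 < m.+2%:R :> R by rewrite ltr0n.
have me : 0 < m.+2%:R * e by rewrite mulr_gt0.
have lt1 : m.+2%:R * e + 1 < m.+2%:R * d + 1 by rewrite ltrD2r ltr_pM2l.
apply: le_lt_trans (_ : e * (m.+2%:R * e + 1) * (1 + d) ^+ m < _).
  rewrite ler_wpM2l //; first by rewrite mulr_ge0 //; lra.
  by apply: lerXn2r; rewrite ?nnegrE; lra.
by rewrite ltr_pM2r ?exprn_gt0 // ltr_pM //; lra.
Qed.

(** * The upper bound *)

Lemma cmod_le_of_power_sums_le1 (R : realType) (n : nat) (L : 'I_n -> R[i])
    (k : 'I_n) :
  (2 <= n)%N -> power_sums_le L 1 -> cmod (L k) <= 1 + eps R n.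
Proof.
move=> n2 SL; have e0 := eps_gt0 R n2.
have [|Lk] := leP (cmod (L k)) 1; first by lra.
pose d := cmod (L k) - 1; have d0 : 0 < d by rewrite subr_gt0.
have dE : cmod (L k) = 1 + d by rewrite /d; ring.
have Lk0 : L k != 0 by rewrite -cmod_gt0; lra.
have zroot : root (recip_poly L) (L k)^-1.
  rewrite /root /recip_poly horner_prod (bigD1 k) //=.
  by rewrite !hornerE mulfV // subrr mul0r.
rewrite dE lerD2l; apply: (@subcritical_le _ n) => //; try lia.
  apply: critical_ineq => // [|N nN]; first by lia.
  have := recip_poly_root_ineq SL zroot nN.
  by rewrite ComplexField.Normc.normcV dE.
exact: eps_supercritical.
Qed.

Lemma power_sumZ (R : realType) (n : nat) (L : 'I_n -> R[i]) (c : R[i]) (m : nat) :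
  power_sum (fun k => c * L k) m = c ^+ m * power_sum L m.
Proof. by rewrite /power_sum mulr_sumr; apply: eq_bigr => k _; rewrite exprMn. Qed.

Lemma cmod_real (R : realType) (a : R) : 0 <= a -> cmod (a%:C)%C = a.
Proof. by move=> a0; rewrite /= expr0n addr0 sqrtr_sqr ger0_norm. Qed.

Lemma power_sums_leZ (R : realType) (n : nat) (L : 'I_n -> R[i]) (a c : R) :
  0 <= c -> power_sums_le L a -> power_sums_le (fun k => (c%:C)%C * L k) (c * a).
Proof.
move=> c0 SL m mn; rewrite power_sumZ ComplexField.Normc.normcM cmodX cmod_real //.
by rewrite exprMn ler_wpM2l ?exprn_ge0 ?SL.
Qed.

Lemma cmod_le_of_power_sums_le (R : realType) (n : nat) (L : 'I_n -> R[i]) (a : R)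
    (k : 'I_n) :
  (2 <= n)%N -> 0 <= a -> power_sums_le L a -> cmod (L k) <= (1 + eps R n) * a.
Proof.
move=> n2 a0 SL; have e0 := eps_gt0 R n2.
(* Rescaling requires a positive bound; the case [a = 0] follows by approximation *)
have pos b : 0 < b -> a <= b -> cmod (L k) <= (1 + eps R n) * b.
  move=> b0 ab; have SLb : power_sums_le L b.
    move=> m mn; apply: le_trans (SL m mn) _.
    by apply: lerXn2r; rewrite ?nnegrE // ltW.
  have b0' : 0 <= b^-1 by rewrite invr_ge0 ltW.
  have := power_sums_leZ b0' SLb; rewrite mulVf ?gt_eqF // => SL1.
  have := cmod_le_of_power_sums_le1 k n2 SL1.
  by rewrite ComplexField.Normc.normcM cmod_real // mulrC ler_pdivrMr.
apply/ler_addgt0Pr => x x0.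
have c0 : 0 < 1 + eps R n by lra.
apply: le_trans (pos (a + x / (1 + eps R n)) _ _) _.
- by rewrite ltr_wpDl ?divr_gt0.
- by rewrite lerDl divr_ge0 // ltW.
by rewrite mulrDr mulrCA divff ?gt_eqF // mulr1.
Qed.

Lemma max_modulus_le (R : realType) (n : nat) (L : 'I_n -> R[i]) (a : R) :
  (2 <= n)%N -> 0 <= a -> power_sums_le L a ->
  max_modulus L <= (1 + eps R n) * a.
Proof.
move=> n2 a0 SL; have e0 := eps_gt0 R n2.
apply: bigmax_le => [|k _]; last exact: cmod_le_of_power_sums_le.
by rewrite mulr_ge0 //; lra.
Qed.

Lemma eps_lt (R : realType) (n : nat) :
  (3 <= n)%N -> eps R n < 2 * ln (n%:R : R) / n%:R.
Proof.
move=> n3; have n0 : (0 : R) < n%:R by rewrite ltr0n; lia.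
have L1 : 1 < ln (n%:R : R).
  by apply: lt_le_trans (ln3_gt1 R) _; rewrite ler_ln ?posrE // ?ler_nat.
rewrite /eps ltr_pM2r ?invr_gt0 // ltr_pM2l // gtrBl; exact: ln_gt0.
Qed.

(** * Bounds for the sine and the cosine *)

Lemma sin_le_id (R : realType) (x : R) : 0 <= x -> sin x <= x.
Proof.
move=> x0; rewrite -subr_ge0.
move: x x0; apply: (@ge0_of_derive_ge0 _ _ (fun x => 1 - cos x)).
  by move=> x _; rewrite subr_ge0 cos_le1.
by rewrite sin0 subrr.
Qed.

Lemma cos_ge_taylor (R : realType) (x : R) : 0 <= x -> 1 - x ^+ 2 / 2 <= cos x.
Proof.
move=> x0; rewrite -subr_ge0.
have -> : cos x - (1 - x ^+ 2 / 2) = cos x - (1 - 2^-1 * (x * x)) by field.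
move: x x0; apply: (@ge0_of_derive_ge0 _ _ (fun x => x - sin x)).
- move=> x _; have dX := is_derive_id x (1 : R); have dC c := is_derive_cst (c : R) x (1 : R).
  apply: (is_derive_eq (is_deriveB (is_derive_cos x)
    (is_deriveB (dC 1) (is_deriveM (dC 2^-1) (is_deriveM dX dX))))).
  by rewrite /GRing.scale /= !fctE; field.
- by move=> x x0; rewrite subr_ge0 sin_le_id.
by rewrite cos0; lra.
Qed.

Lemma sin_ge_taylor (R : realType) (x : R) : 0 <= x -> x - x ^+ 3 / 6 <= sin x.
Proof.
move=> x0; rewrite -subr_ge0.
have -> : sin x - (x - x ^+ 3 / 6) = sin x - (x - 6^-1 * (x * (x * x))) by field.
move: x x0.
apply: (@ge0_of_derive_ge0 _ _ (fun x => cos x - (1 - x ^+ 2 / 2))).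
- move=> x _; have dX := is_derive_id x (1 : R); have dC c := is_derive_cst (c : R) x (1 : R).
  apply: (is_derive_eq (is_deriveB (is_derive_sin x)
    (is_deriveB dX (is_deriveM (dC 6^-1) (is_deriveM dX (is_deriveM dX dX)))))).
  by rewrite /GRing.scale /= !fctE; field.
- by move=> x x0; rewrite subr_ge0 cos_ge_taylor.
by rewrite sin0; lra.
Qed.

Lemma sin_piquarter (R : realType) : sin (pi / 4 : R) = cos (pi / 4).
Proof. by rewrite -cosBpihalf -cosN; congr cos; field. Qed.

Lemma cos_piquarter_ge (R : realType) : 7 / 10 <= cos (pi / 4 : R).
Proof.
have pi2 := pi_ge2 R.
have c0 : 0 < cos (pi / 4 : R) by apply: cos_gt0_pihalf; lra.
have := cos2Dsin2 (pi / 4 : R); rewrite sin_piquarter.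
by rewrite leNgt => c2; apply/negP => c7; nra.
Qed.

(** * Families whose power sums are 1, except the last *)

(** The trinomial [1 - X + b X^n], reciprocal of [X^n - X^(n-1) + b]. *)
Definition trinomial (F : nzRingType) (n : nat) (b : F) : {poly F} :=
  1 - 'X + b *: 'X^n.

Lemma coef_trinomial (F : nzRingType) (n : nat) (b : F) (m : nat) :
  (2 <= n)%N -> (trinomial n b)`_m =
    if m == 0%N then 1 else if m == 1%N then -1 else if m == n then b else 0.
Proof.
move=> n2; rewrite /trinomial coefD coefB coefZ coef1 coefX coefXn.
case: m => [|[|m]] /=; rewrite ?subr0 ?sub0r ?add0r.
- by rewrite (_ : 0%N == n = false) ?mulr0 ?addr0 //; lia.
- by rewrite (_ : 1%N == n = false) ?mulr0 ?addr0 //; lia.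
by case: eqP; rewrite ?mulr1 ?mulr0.
Qed.

(** The condition on [b] says that [1 / l] is a root of the trinomial. *)
Lemma trinomial_recip_poly (R : realType) (n : nat) (l b : R[i]) :
  (2 <= n)%N -> l != 0 -> b != 0 -> b = l ^+ n.-1 - l ^+ n ->
  exists L : 'I_n -> R[i], recip_poly L = trinomial n b /\
    forall k : 'I_n, k = 0%N :> nat -> L k = l.
Proof.
move=> n2 l0 b0 bE; set p := trinomial n b.
have pn : p`_n = b.
  by rewrite coef_trinomial // eqxx !ifF //; lia.
have sp : size p = n.+1.
  apply/eqP; rewrite eqn_leq; apply/andP; split.
    by apply/leq_sizeP => j nj; rewrite coef_trinomial // !ifF //; lia.
  rewrite ltnNge; apply/negP => /leq_sizeP/(_ n (leqnn n)).
  by rewrite pn => /eqP; apply/negP.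
have lcp : lead_coef p = b.
  by rewrite /lead_coef sp.
have [rs pE] := closed_field_poly_normal p.
rewrite lcp in pE.
have srs : size rs = n.
  by move: sp; rewrite pE size_scale // size_prod_XsubC => -[].
have p0 : p.[0] = 1.
  by rewrite horner_coef0 coef_trinomial.
have rs0 : 0 \notin rs.
  rewrite -root_prod_XsubC; apply/negP => /rootP H.
  by move/eqP: p0; rewrite pE hornerZ H mulr0 eq_sym oner_eq0.
have lrs : l^-1 \in rs.
  rewrite -root_prod_XsubC -(rootZ _ _ b0) -pE; apply/rootP.
  rewrite /p /trinomial !hornerE bE.
  have -> : l ^+ n = l * l ^+ n.-1 by rewrite -exprS prednK //; lia.
  have -> : l^-1 ^+ n = l^-1 * l^-1 ^+ n.-1 by rewrite -exprS prednK //; lia.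
  have ln0 : l ^+ n.-1 != 0 by rewrite expf_neq0.
  by rewrite exprVn; field; rewrite l0 ln0.
pose ts := l^-1 :: rem l^-1 rs.
have tsP : perm_eq rs ts := perm_to_rem lrs.
have sts : size ts = n by rewrite -(perm_size tsP).
pose L (k : 'I_n) := (ts`_k)^-1.
exists L; split; last by move=> k k0; rewrite /L k0 invrK.
have t0 k : (k < n)%N -> ts`_k != 0.
  move=> kn; apply: contraNneq rs0 => <-.
  by rewrite (perm_mem tsP) mem_nth // sts.
have pE' : p = b *: \prod_(k < n) ('X - (ts`_k)%:P).
  by rewrite pE (perm_big _ tsP) /= (big_nth 0) sts big_mkord.
pose c := b * \prod_(k < n) - ts`_k.
have pc : p = c *: recip_poly L.
  rewrite pE' /c -scalerA -scaler_prod; congr (_ *: _); apply: eq_bigr => k _.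
  rewrite scalerBr scalerA mulNr mulfV ?t0 // scaleN1r opprK addrC.
  by rewrite -alg_polyC scaleNr.
have c1 : c = 1.
  have := congr1 (fun q : {poly R[i]} => q.[0]) pc.
  by rewrite p0 hornerZ horner_coef0 recip_poly0 mulr1.
by rewrite pc c1 scale1r.
Qed.

Lemma trinomial_power_sums (R : realType) (n : nat) (L : 'I_n -> R[i]) (b : R[i]) :
  (2 <= n)%N -> recip_poly L = trinomial n b ->
  (forall m, (1 <= m < n)%N -> power_sum L m = 1) /\
  power_sum L n = 1 - n%:R * b.
Proof.
move=> n2 LE.
have step m : (m.+1 < n)%N -> m.+2%:R * (recip_poly L)`_m.+2 =
    - (power_sum L m.+2 - power_sum L m.+1).
  move=> mn; rewrite newton_coef LE; congr -%R.
  rewrite !big_ord_recr /= big1 ?add0r => [|i _]; last first.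
    by rewrite coef_trinomial // !ifF ?mulr0 //; have := ltn_ord i; lia.
  by rewrite subnn subSnn !coef_trinomial //=; ring.
have S1 : forall m, (1 <= m < n)%N -> power_sum L m = 1.
  elim=> [//|[_ _|m IH /= mn]].
    have := newton_coef L 0; rewrite LE big_ord1 !coef_trinomial //=.
    by rewrite mulr1 mul1r => /oppr_inj.
  have := step m (ltnW mn); rewrite LE coef_trinomial //= ifF ?mulr0; last by lia.
  by move/esym/eqP; rewrite oppr_eq0 subr_eq0 IH ?(ltnW mn) // => /eqP.
split=> //; pose m := n.-2; have nE : m.+2 = n by rewrite /m; lia.
have := step m ltac:(lia); rewrite nE (S1 m.+1); last by lia.
rewrite LE coef_trinomial // eqxx !ifF; try lia.
by move=> ->; ring.
Qed.

Lemma exists_power_sums_one (R : realType) (n : nat) (l : R[i]) :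
  (2 <= n)%N -> l != 0 -> l != 1 ->
  exists L : 'I_n -> R[i],
    [/\ forall k : 'I_n, k = 0%N :> nat -> L k = l,
        forall m, (1 <= m < n)%N -> power_sum L m = 1 &
        power_sum L n = 1 - n%:R * (l ^+ n.-1 - l ^+ n)].
Proof.
move=> n2 l0 l1; pose b := l ^+ n.-1 - l ^+ n.
have b0 : b != 0.
  have -> : b = l ^+ n.-1 * (1 - l).
    by rewrite mulrBr mulr1 -exprSr prednK //; lia.
  by rewrite mulf_neq0 ?expf_neq0 // subr_eq0 eq_sym.
have [L [LE Lk]] := trinomial_recip_poly n2 l0 b0 (erefl b).
by have [S1 Sn] := trinomial_power_sums n2 LE; exists L.
Qed.

(** * Sharpness of the upper bound *)

Lemma de_moivre (R : realType) (r t : R) (k : nat) :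
  ((r * cos t) +i* (r * sin t))%C ^+ k =
    ((r ^+ k * cos (k%:R * t)) +i* (r ^+ k * sin (k%:R * t)))%C.
Proof.
elim: k => [|k IH].
  by rewrite !expr0 mul0r cos0 sin0 mulr1 mulr0.
rewrite exprS IH -[in RHS]natr1 mulrDl mul1r (addrC (k%:R * t)) cosD sinD exprS.
by simpc; congr (_ +i* _)%C; ring.
Qed.

(** With [l = r exp (i t)] and [n t = pi / 4], this is the inequality
    [n |l^(n-1)| |1 - l|^2 <= 2 Re ((l^(n-1) - l^n) / |l^(n-1)|)].  To first order
    in [1 / n] it reads [exp (1/10) (1/100 + h^2) <= 2 cos h (h - 1/10)] with
    [h = pi / 4]; it holds for every [h] between 1/2 and 1 when [cos h] is replaced
    by 7/10, so that crude bounds on [pi] suffice. *)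
Lemma extremal_ineq (R : realType) (n : nat)
    (t := pi / 4 / n%:R) (r := 1 + 10^-1 / n%:R) :
  (100 <= n)%N ->
  n%:R * r ^+ n.-1 * (1 - 2 * r * cos t + r ^+ 2) <=
    2 * cos (pi / 4) * (cos t + sin t - r : R).
Proof.
move=> n100; have nS : n.-1.+1 = n by apply: prednK; apply: leq_trans n100.
set h : R := pi / 4.
have pi2 := pi_ge2 R. have pi4 := pihalf_lt2 R.
have h_ge : 1 / 2 <= h by rewrite /h; lra.
have h_le : h <= 1 by rewrite /h; lra.
have n0 : (0 : R) < n%:R by rewrite ltr0n; lia.
have n_ge : (100 : R) <= n%:R by rewrite (ler_nat _ 100).
pose y : R := n%:R^-1; have y0 : 0 < y by rewrite invr_gt0.
have y_le : y <= 1 / 100 by rewrite /y -div1r ler_pdivrMr //; lra.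
have ny : n%:R * y = 1 by rewrite mulfV // gt_eqF.
have tE : t = h * y by [].
have rE : r = 1 + y / 10 by rewrite /r /y mulrC.
move: (t) (r) tE rE => {}t {}r tE rE.
have r1 : 1 <= r by rewrite rE; lra.
have t0 : 0 <= t by rewrite tE mulr_ge0 //; lra.
have t_le : t <= 1 / 100 by rewrite tE; nra.
have cosL := cos_ge_taylor t0. have sinL := sin_ge_taylor t0.
have k7 := cos_piquarter_ge R.
have rn : r ^+ n.-1 * r <= 10 / 9.
  rewrite -exprSr nS.
  apply: le_trans (_ : expR (y / 10) ^+ n <= _).
    by apply: lerXn2r; rewrite ?nnegrE ?expR_ge0 ?rE ?expR_ge1Dx //; lra.
  rewrite -expRM_natl mulrA ny -[X in X <= _]invrK -expRN.
  have e9 : 9 / 10 <= expR (- (1 / 10)) :> R.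
    by apply: le_trans (expR_ge1Dx _); lra.
  rewrite (_ : 10 / 9 = (9 / 10)^-1); last by field.
  by rewrite lef_pV2 ?posrE ?expR_gt0 //; lra.
set w := r ^+ n.-1 in rn *.
have w0 : 0 < w by rewrite exprn_gt0 //; lra.
(* 1 - 2 r cos t + r^2 = (r - 1)^2 + 2 r (1 - cos t) *)
have q_le : 1 - 2 * r * cos t + r ^+ 2 <= r * (1 / 100 + h ^+ 2) * y ^+ 2.
  have : r * (1 - t ^+ 2 / 2) <= r * cos t by rewrite ler_wpM2l //; lra.
  have : 1 * y ^+ 2 <= r * y ^+ 2 by rewrite ler_wpM2r ?sqr_ge0.
  rewrite tE rE; lra.
have lhs_le : n%:R * w * (1 - 2 * r * cos t + r ^+ 2) <=
    10 / 9 * (1 / 100 + h ^+ 2) * y.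
  have nw : 0 <= n%:R * w by rewrite mulr_ge0 // ltW.
  apply: le_trans (ler_wpM2l nw q_le) _.
  rewrite (_ : n%:R * w * _ = w * r * ((1 / 100 + h ^+ 2) * y) * (n%:R * y)).
    rewrite ny mulr1 -[leRHS]mulrA ler_wpM2r // mulr_ge0 ?(ltW y0) //.
    by have := sqr_ge0 h; lra.
  by ring.
apply: le_trans lhs_le _.
have rhs_ge : (99 / 100 * h - 1 / 10) * y <= cos t + sin t - r.
  have t2 : t ^+ 2 / 2 + t ^+ 3 / 6 <= 1 / 100 * t.
    rewrite -subr_ge0.
    rewrite (_ : _ - _ = t * (1 / 100 - t / 2 - t ^+ 2 / 6)); last by field.
    by rewrite mulr_ge0 // expr2; nra.
  rewrite rE; lra.
have rhs0 : 0 <= (99 / 100 * h - 1 / 10) * y by rewrite mulr_ge0 ?ltW //; lra.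
apply: le_trans (_ : 2 * (7 / 10) * ((99 / 100 * h - 1 / 10) * y) <= _).
  rewrite mulrA ler_wpM2r ?ltW //.
  by nra.
apply: ler_pM => //; lra.
Qed.

Lemma cmod_polar (R : realType) (r t : R) : 0 <= r ->
  cmod ((r * cos t) +i* (r * sin t))%C = r.
Proof.
move=> r0; rewrite /= (_ : _ + _ = r ^+ 2 * (cos t ^+ 2 + sin t ^+ 2)); last by ring.
by rewrite cos2Dsin2 mulr1 sqrtr_sqr ger0_norm.
Qed.

(** Writing [1 - S_n = A (x + i y)] with [A = n |l^(n-1)|], the bound [|S_n| <= 1]
    means [A (x^2 + y^2) <= 2 x]. *)
Lemma extremal_last_power_sum (R : realType) (n : nat)
    (t := pi / 4 / n%:R : R) (r := 1 + 10^-1 / n%:R : R)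
    (l := ((r * cos t) +i* (r * sin t))%C) :
  (100 <= n)%N -> cmod (1 - n%:R * (l ^+ n.-1 - l ^+ n)) <= 1.
Proof.
move=> n100; have n0 : (0 < n)%N by apply: leq_trans n100.
have nR : (0 : R) < n%:R by rewrite ltr0n.
have r0 : 0 < r by rewrite addr_gt0 // divr_gt0 // invr_gt0.
have nS : n.-1.+1 = n by exact: prednK.
have nt : n%:R * t = pi / 4 by rewrite /t mulrC divfK // gt_eqF.
have nt1 : n.-1%:R * t = pi / 4 - t.
  by rewrite -nt -[in RHS]nS -natr1 mulrDl mul1r addrK.
have key := extremal_ineq R n100; rewrite -/t -/r in key.
rewrite /l !de_moivre nt nt1 sin_piquarter cosB sinB sin_piquarter.
have : r ^+ n = r ^+ n.-1 * r by rewrite -exprSr nS.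
set w := r ^+ n.-1 in key * => ->.
have : 0 < n%:R * w by rewrite mulr_gt0 ?exprn_gt0.
set k := cos (pi / 4) in key *.
have k2 : k ^+ 2 = 2^-1.
  by have := cos2Dsin2 (pi / 4 : R); rewrite sin_piquarter -/k; lra.
have cs := cos2Dsin2 t.
move: (cos t) (sin t) cs key => C S cs key nw0.
have -> : (n%:R : R[i]) = (n%:R +i* 0)%C.
  by rewrite -[LHS](rmorph_nat (real_complex R)).
rewrite (_ : 1 - _ = (1 - n%:R * w * (k * (C + S - r))) +i*
                     (- (n%:R * w * (k * (C - S - r)))))%C; last first.
  by apply/eqP; rewrite eq_complex /=; apply/andP; split; apply/eqP; ring.
rewrite -[leRHS](sqrtr1 R) ler_wsqrtr //.
move: (n%:R * w) nw0 key => A A0 key.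
have sq : (k * (C + S - r)) ^+ 2 + (k * (C - S - r)) ^+ 2 = 1 - 2 * r * C + r ^+ 2.
  rewrite (_ : _ + _ = k ^+ 2 * (2 * (C ^+ 2 + S ^+ 2 - 2 * r * C + r ^+ 2))).
    by rewrite k2 cs; field.
  by ring.
rewrite -subr_ge0 (_ : _ - _ = A * (2 * k * (C + S - r) - A *
   ((k * (C + S - r)) ^+ 2 + (k * (C - S - r)) ^+ 2))); last by ring.
by rewrite mulr_ge0 ?(ltW A0) // subr_ge0 sq.
Qed.

Lemma exists_large_member (R : realType) (n : nat) (a : R) :
  (100 <= n)%N -> 0 <= a ->
  exists L : 'I_n -> R[i], power_sums_le L a /\
    exists2 k : 'I_n, k = 0%N :> nat &
      cmod (L k) = (1 + 10^-1 / n%:R) * a.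
Proof.
move=> n100 a0; have n0 : (0 < n)%N by apply: leq_trans n100.
have n2 : (2 <= n)%N by apply: leq_trans n100.
have nR : (0 : R) < n%:R by rewrite ltr0n.
set r := 1 + 10^-1 / n%:R; pose t : R := pi / 4 / n%:R.
have r1 : 1 < r by rewrite ltrDl divr_gt0 // invr_gt0.
pose l := ((r * cos t) +i* (r * sin t))%C.
have lr : cmod l = r by apply: cmod_polar; lra.
have l0 : l != 0 by rewrite -cmod_gt0 lr; lra.
have l1 : l != 1.
  by apply: contraTneq r1 => l1; rewrite -lr l1 ComplexField.Normc.normc1 ltxx.
have [L [L0 S1 Sn]] := exists_power_sums_one n2 l0 l1.
exists (fun k => (a%:C)%C * L k); split; last first.
  exists (Ordinal n0) => //; rewrite ComplexField.Normc.normcM cmod_real // L0 //.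
  by rewrite lr mulrC.
rewrite -[X in power_sums_le _ X](mulr1 a); apply: power_sums_leZ => // m /andP[m1].
rewrite expr1n leq_eqVlt => /predU1P[->|mn].
  by rewrite Sn; exact: extremal_last_power_sum.
by rewrite S1 ?m1 // ComplexField.Normc.normc1.
Qed.

Theorem theorem1 (R : realType) :
  (forall n : nat, (2 <= n)%N ->
     (forall (L : 'I_n -> R[i]) (a : R), 0 <= a ->
        power_sums_le L a -> max_modulus L <= (1 + eps R n) * a) /\
     ((3 <= n)%N -> eps R n < 2 * ln (n%:R : R) / n%:R)) /\
  (exists n0 : nat, (0 < n0)%N /\
     forall n : nat, (n0 <= n)%N ->
       exists c : R, 1 / 10 <= c <= 1 /\
         forall a : R, 0 <= a ->
           exists L : 'I_n -> R[i],
             power_sums_le L a /\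
             exists2 k : 'I_n, k = 0%N :> nat &
               cmod (L k) = (1 + c / n%:R) * a).
Proof.
split=> [n n2|].
  split=> [L a a0 SL|]; last exact: eps_lt.
  exact: max_modulus_le.
exists 100%N; split=> // n n100; exists 10^-1; split; first by apply/andP; split; lra.
by move=> a a0; exact: exists_large_member.
Qed.
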